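(* Let $H$ be a dag that is not a rooted star. Then $\tau(H,D_n)=\Theta(\log n)$; that is, there are constants $c,C>0$ depending only on $H$ such that $c\log n\le \tau(H,D_n)\le C\log n$ for all sufficiently large $n$.
   Context: All graphs are simple finite directed graphs; $H$ has at least two edges and no isolated vertices. A dag is a directed graph with no directed cycle. $D_n$ is the complete directed graph on $n$ vertices (all $n(n-1)$ ordered pairs are edges). $H$ is a rooted star if its underlying undirected graph is a star and the center is either a source (all edges point away from it) or a sink (all edges point into it). For a directed graph $G$ on vertex set $[n]$ and a permutation $\pi$ of $V(G)$, $G_L(\pi)$ is the spanning subgraph with edge set $\{(i,j)\in E(G):\pi(i)<\pi(j)\}$. An $H$-copy of $G$ (a subgraph of $G$ isomorphic to $H$) is covered by $\pi$ if it is a subgraph of $G_L(\pi)$. $\tau(H,G)$ is the smallest integer $t$ such that there are permutations $\pi_1,\dots,\pi_t$ of $V(G)$ such that every $H$-copy of $G$ is covered by at least one $\pi_i$. Logarithms are base 2. *)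

(* Defs.v *)
From mathcomp Require Import all_boot all_order all_algebra all_fingroup.
From mathcomp Require Import boolp classical_sets reals exp.

Set Implicit Arguments.
Unset Strict Implicit.
Unset Printing Implicit Defensive.

Import Order.TTheory GRing.Theory Num.Theory.

Local Open Scope nat_scope.

(* A vertex set and an edge set inside an ambient finite type, so that a graph,
   its spanning subgraphs and its arbitrary subgraphs are of the same type.
   Both (x, y) and (y, x) may be edges; loops and multiple edges may not. *)
Record digraph (T : finType) := Digraph {
  vset : {set T};
  eset : {set T * T};
  eset_wf : eset \subset
    [set p : T * T | [&& p.1 \in vset, p.2 \in vset & p.1 != p.2]]
}.

Section Digraph.
Variables (T : finType) (G : digraph T).

Definition edge : rel T := fun x y => (x, y) \in eset G.

Definition uedge : rel T := fun x y => edge x y || edge y x.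

Definition no_isolated : Prop :=
  forall x, x \in vset G -> exists y, uedge x y.

Definition dag : Prop := forall c : seq T, 1 < size c -> ~ ucycle edge c.

Definition star_at (c : T) : Prop :=
  c \in vset G /\
  {in vset G &, forall x y, uedge x y = (x != y) && ((x == c) || (y == c))}.

Definition rooted_star : Prop :=
  exists c, star_at c /\
    ((forall x y, edge x y -> x = c) \/ (forall x y, edge x y -> y = c)).

Definition subgraph (F : digraph T) : Prop :=
  vset F \subset vset G /\ eset F \subset eset G.

End Digraph.

Definition isomorphic (T U : finType) (A : digraph T) (B : digraph U) : Prop :=
  exists f : T -> U,
    [/\ {in vset A &, injective f},
        f @: vset A = vset B
      & {in vset A &, forall x y, edge B (f x) (f y) = edge A x y}].

Definition is_copy (T U : finType) (H : digraph T) (G F : digraph U) : Prop :=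
  subgraph G F /\ isomorphic H F.

Lemma complete_wf n : [set p : 'I_n * 'I_n | p.1 != p.2] \subset
  [set p : 'I_n * 'I_n |
    [&& p.1 \in [set: 'I_n], p.2 \in [set: 'I_n] & p.1 != p.2]].
Proof. by apply/fintype.subsetP => p; rewrite !inE. Qed.

Definition complete n : digraph 'I_n := Digraph (complete_wf n).

Section Tau.
Variables (T : finType) (H : digraph T).

(* For a graph whose vertex set is all of 'I_n, the permutations of its
   vertices are the elements of 'S_n. *)
Variables (n : nat) (G : digraph 'I_n).

Lemma left_graph_wf (pi : 'S_n) :
  [set p in eset G | pi p.1 < pi p.2] \subset
  [set p : 'I_n * 'I_n | [&& p.1 \in vset G, p.2 \in vset G & p.1 != p.2]].
Proof.
apply/fintype.subsetP => p; rewrite inE => /andP[pG _].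
exact: (fintype.subsetP (eset_wf G)).
Qed.

Definition left_graph (pi : 'S_n) : digraph 'I_n := Digraph (left_graph_wf pi).

Definition covering (t : nat) (pi : 'I_t -> 'S_n) : Prop :=
  forall F : digraph 'I_n, is_copy H G F ->
    exists i, subgraph (left_graph (pi i)) F.

Definition coverable (t : nat) : Prop := exists pi : 'I_t -> 'S_n, covering pi.

Definition least_coverable (t : nat) : Prop :=
  coverable t /\ forall s, coverable s -> t <= s.

(* The value is 0 if no family of permutations is covering, which can happen
   only if H has a directed cycle. *)
Definition tau : nat := xget 0 [set t | least_coverable t]%classic.

Lemma tauP t : coverable t -> least_coverable tau.
Proof.
move=> cov_t; apply: (@xgetPex _ 0 [set t | least_coverable t]%classic).
have ex : exists t, `[< coverable t >] by exists t; apply/asboolP.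
exists (ex_minn ex); case: ex_minnP => m /asboolP cov_m min_m.
by split=> // s cov_s; apply/min_m/asboolP.
Qed.

End Tau.

Definition log2 (R : realType) (x : R) : R := (ln x / ln 2)%R.

(* Main.v *)
(* A family of permutations covers every H-copy of D_n iff every embedding of H
   into [n] is increasing along the edges of H for some member of the family.
   Upper bound: color [n] at random by the vertices of H and sort [n] by the
   topological rank of the color.  An embedding g is increasing as soon as each
   g x gets color x, which has probability |T|^-|V(H)| independently of n, so
   the union bound over the at most n^|T| embeddings needs O(log n) colorings.
   Lower bound: a dag that is not a rooted star contains a path a -> b -> c or
   two disjoint edges.  In the first case, fix y and record for each x != y the
   set of permutations that put x before y; these sets are distinct, as
   otherwise no permutation puts x < y < z.  In the second case, split [n] into
   disjoint pairs and record for each pair the set of permutations that put its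
   elements in increasing order; equal sets for {x < y} and {z < w} would
   exclude a permutation with x before y and w before z. *)
Require Import Defs.
From mathcomp Require Import all_boot all_order all_algebra all_fingroup.
From mathcomp Require Import boolp classical_sets reals exp.
From mathcomp Require Import zify lra.

Set Implicit Arguments.
Unset Strict Implicit.
Unset Printing Implicit Defensive.

Import Order.TTheory GRing.Theory Num.Theory.

Local Open Scope nat_scope.

(** * The probabilistic method in counting form *)

Lemma union_bound (I A : finType) (B : I -> pred A) :
  \sum_i #|B i| < #|A| -> exists a, forall i, ~~ B i a.
Proof.
move=> ltBA; case: (pickP (fun a => [forall i, ~~ B i a])) => [a|noA].
  by move/forallP=> Ba; exists a.
case/negP: (negbT (ltn_geF ltBA)).
under eq_bigr => i _ do rewrite -sum1_card big_mkcond /=.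
rewrite exchange_big /= -sum1_card; apply: leq_sum => a _.
have /negbT := noA a; rewrite negb_forall => /existsP[i]; rewrite negbK => Bia.
by rewrite (bigD1 i) //= unfold_in Bia.
Qed.

(** A random entry misses [good i] with probability at most p/(p+1), so [t] independent entries all
    miss it with probability at most (p/(p+1))^t; a union bound over [I] concludes. *)
Lemma hitting_tuple (I A : finType) (good : I -> pred A) (p t : nat) :
  0 < #|A| -> (forall i, #|A| <= p.+1 * #|good i|) ->
  #|I| * p ^ t < p.+1 ^ t ->
  exists a : 'I_t -> A, forall i, exists j, good i (a j).
Proof.
move=> A_gt0 goodP lt_t.
pose B i (a : {ffun 'I_t -> A}) := [forall j, ~~ good i (a j)].
suff /union_bound[a aP] : \sum_i #|B i| < #|{ffun 'I_t -> A}|.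
  exists a => i; have := aP i; rewrite negb_forall => /existsP[j].
  by rewrite negbK; exists j.
have cardB i : #|B i| = #|predC (good i)| ^ t.
  rewrite -[in RHS](card_ord t) -card_ffun_on; apply: eq_card => a.
  apply/idP/idP.
    by move=> /forallP aP; apply/ffun_onP => j; have := aP j; rewrite inE.
  by move=> /ffun_onP aP; apply/forallP => j; have := aP j; rewrite inE.
rewrite card_ffun card_ord -(ltn_pmul2l (expn_gt0 p.+1 t)) big_distrr /=.
apply: (@leq_ltn_trans (\sum_(i : I) (p * #|A|) ^ t)).
  apply: leq_sum => i _; rewrite cardB -expnMn.
  have [->//|/leq_exp2r ->] := posnP t.
  rewrite -(leq_add2l (p.+1 * #|good i|)) -mulnDr cardC mulSn leq_add2r.
  exact: goodP.
rewrite sum_nat_const expnMn mulnA ltn_pmul2r // expn_gt0 A_gt0 //.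
Qed.

(** Bernoulli's inequality (1 + 1/p)^m >= 1 + m/p at m = p + 1, denominators cleared. With q = p +
    1, it says that q trials of success probability 1/q all fail with probability at most 1/2. *)
Lemma double_expn_le (p : nat) : 2 * p ^ p.+1 <= p.+1 ^ p.+1.
Proof.
have bernoulli m : p ^ m * (p + m) <= p * p.+1 ^ m.
  elim: m => [|m IHm]; first by rewrite !expn0 addn0 mul1n muln1.
  rewrite [p.+1 ^ _]expnSr mulnA (leq_trans _ (leq_mul IHm (leqnn _))) //.
  rewrite expnSr -!mulnA leq_mul2l; apply/orP; right.
  nia.
case: p bernoulli => [|p] // /(_ p.+2).
set a := _ ^ _; set b := _ ^ _ => le_ab.
rewrite -(leq_pmul2l (ltn0Sn p)) (leq_trans _ le_ab) // mulnA mulnC leq_mul2l.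
by rewrite muln2 -addnn leq_add2l leqnSn orbT.
Qed.

(** * Permutations from sorting keys and from partial injections *)

Lemma perm_of_inj_key (n : nat) (K : 'I_n -> nat) : injective K ->
  exists s : 'S_n, forall a b, K a < K b -> s a < s b.
Proof.
move=> injK; pose below a := [set b | K b < K a].
have lt_below a : #|below a| < n.
  rewrite -[X in _ < X]card_ord -cardsT proper_card // properT.
  by apply/eqP => /setP/(_ a); rewrite !inE ltnn.
have mono a b : K a < K b -> #|below a| < #|below b|.
  move=> ltab; apply/proper_card/properP; split; last first.
    by exists a; rewrite !inE ?ltnn.
  by apply/fintype.subsetP => c; rewrite !inE => /ltn_trans; apply.
have inj : injective (fun a => Ordinal (lt_below a)).
  move=> a b /(congr1 val) /= eqab; apply: injK; apply/eqP.
  by case: ltngtP => // /mono; rewrite eqab ltnn.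
by exists (perm inj) => a b ltab; rewrite !permE; apply: mono.
Qed.

Lemma perm_of_key (n : nat) (K : 'I_n -> nat) :
  exists s : 'S_n, forall a b, K a < K b -> s a < s b.
Proof.
(* Ties are broken by the index, which is below [n]. *)
have [|s sP] := @perm_of_inj_key n (fun a => K a * n + a).
  move=> a b eqab; apply: val_inj; have := congr1 (modn^~ n) eqab.
  by rewrite /= !modnMDl !modn_small.
exists s => a b ltab; apply: sP.
by have := leq_mul ltab (leqnn n); have := ltn_ord a; rewrite mulSn; lia.
Qed.

Lemma perm_map_exists (X : finType) (s1 s2 : seq X) :
  uniq s1 -> uniq s2 -> size s1 = size s2 ->
  exists s : {perm X}, map s s1 = s2.
Proof.
elim: s1 s2 => [|a s1 IH] [|b s2] //=; first by exists 1%g.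
move=> /andP[a1 u1] /andP[b2 u2] [sz]; have [s eqs] := IH _ u1 u2 sz.
(* By uniqueness neither [s a] nor [b] occurs in the tail [s2], so the transposition leaves the
   values already arranged in place. *)
exists (s * tperm (s a) b)%g; rewrite permM tpermL; congr cons.
rewrite -[RHS]eqs; apply/eq_in_map => x x1; rewrite permM tpermD //.
  by rewrite (inj_eq perm_inj); apply: contraNneq a1 => ->.
by apply: contraNneq b2 => ->; rewrite -eqs map_f.
Qed.

(** * Upper bound: random colorings *)

Section DagCoverings.
Variables (T : finType) (H : digraph T).

Lemma edge_vset x y :
  edge H x y -> [/\ x \in vset H, y \in vset H & x != y].
Proof. by move/(fintype.subsetP (eset_wf H)); rewrite inE => /and3P. Qed.

(** The rank counts the vertices from which [x] is reachable. Along an edge from [x] to [y] it gains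
    at least [y] itself, since a path from [y] back to [x] would close a cycle. *)
Lemma dag_rank : dag H ->
  exists r : T -> nat, forall x y, edge H x y -> r x < r y.
Proof.
move=> dagH; exists (fun x => #|[set z | connect (edge H) z x]|) => x y xy.
apply/proper_card/properP; split.
  apply/fintype.subsetP => z; rewrite !inE => zx.
  exact: connect_trans zx (connect1 xy).
exists y; rewrite !inE ?connect0 //; apply/negP => /connectP[p py xE].
move: xE; case/shortenP: py => q yq uq _ xE.
have [_ _ neq] := edge_vset xy.
apply: (dagH (y :: q)).
  by case: q xE {yq uq} => //= xE; rewrite xE eqxx in neq.
by rewrite /ucycle /= rcons_path yq -xE xy.
Qed.

Lemma coveringP (n t : nat) (pi : 'I_t -> 'S_n) :
  covering H (complete n) pi <->
  forall g : T -> 'I_n, {in vset H &, injective g} ->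
    exists i, forall x y, edge H x y -> pi i (g x) < pi i (g y).
Proof.
split=> [cov g injg|cov F [_ [g [injg gV gE]]]].
  (* The image of [H] under [g] is the copy to be covered. *)
  have wf : [set (g p.1, g p.2) | p in eset H] \subset
      [set p : 'I_n * 'I_n |
        [&& p.1 \in g @: vset H, p.2 \in g @: vset H & p.1 != p.2]].
    apply/fintype.subsetP => _ /imsetP[[x y] xy ->]; rewrite inE /=.
    have [xV yV neq] := edge_vset xy.
    by rewrite !imset_f //= (inj_in_eq injg).
  case: (cov (Digraph wf)) => [|i [_ /= /fintype.subsetP sub]].
    split.
      split; first exact: finset.subsetT.
      apply/fintype.subsetP => p /(fintype.subsetP wf); rewrite !inE.
      by case/and3P.
    exists g; split=> // x y xV yV; apply/imsetP/idP => [[[a b] ab [ga gb]]|xy].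
      have [aV bV _] := edge_vset ab.
      by rewrite (injg _ _ xV aV ga) (injg _ _ yV bV gb).
    by exists (x, y).
  exists i => x y xy.
  have := sub (g x, g y) (imset_f (fun p => (g p.1, g p.2)) xy).
  by rewrite inE => /andP[].
have [i iP] := cov g injg; exists i; split; first exact: finset.subsetT.
apply/fintype.subsetP => -[a b] ab.
have := fintype.subsetP (eset_wf F) _ ab; rewrite inE -gV /=.
case/and3P=> /imsetP[x xV ax] /imsetP[y yV byy] neq; rewrite !inE neq /= ax byy.
by apply: iP; rewrite -gE // /edge -ax -byy.
Qed.

(** The condition on [f] splits over the points of ['I_n]: the color is forced on the image of [g]
    and free elsewhere, so each image point costs one factor [#|T|]. *)
Lemma card_good_colorings n (g : T -> 'I_n) : {in vset H &, injective g} ->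
  #|T| ^ n <= #|T| ^ #|vset H| *
    #|[pred f : {ffun 'I_n -> T} | [forall x in vset H, f (g x) == x]]|.
Proof.
move=> injg.
pose F y := [pred z | [forall x in vset H, (g x == y) ==> (x == z)]].
have -> : #|[pred f : {ffun 'I_n -> T} | [forall x in vset H, f (g x) == x]]|
    = #|(family F : simpl_pred {ffun 'I_n -> T})|.
  apply: eq_card => f; rewrite inE.
  apply/forall_inP/familyP => [fP y|fP x xV].
    rewrite inE; apply/forall_inP => x xV; apply/implyP => /eqP <-.
    by rewrite eq_sym fP.
  by move/forall_inP: (fP (g x)) => /(_ x xV); rewrite eqxx eq_sym.
rewrite card_family foldrE big_map big_enum /=.
have -> : #|T| ^ #|vset H| =
    \prod_(y < n) (if y \in g @: vset H then #|T| else 1).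
  by rewrite -big_mkcond /= prod_nat_const card_in_imset.
rewrite -big_split /= -[X in _ ^ X]card_ord -prod_nat_const.
apply: leq_prod => y _; case: ifPn => [/imsetP[x xV ->]|yN].
  rewrite leq_pmulr //; apply/card_gt0P; exists x.
  by apply/forall_inP => z zV; apply/implyP => /eqP/(injg _ _ zV xV) ->.
rewrite mul1n subset_leq_card //; apply/fintype.subsetP => z _.
apply/forall_inP => x xV; apply/implyP => /eqP gx.
by rewrite -gx imset_f in yN.
Qed.

Lemma coverable_log n : dag H -> 0 < #|T| ->
  coverable H (complete n)
    (#|T| ^ #|vset H| * (#|T| * (trunc_log 2 n).+1)).
Proof.
move=> dagH T_gt0; set q := _ ^ _; set m := #|T| * _.
have [r rP] := dag_rank dagH.
have q_gt0 : 0 < q by rewrite expn_gt0 T_gt0.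
(* Maps that are not embeddings accept every coloring, so the union bound may run over all
   functions. *)
pose good (g : {ffun T -> 'I_n}) (f : {ffun 'I_n -> T}) :=
  dinjectiveb g (vset H) ==> [forall x in vset H, f (g x) == x].
(* A coloring is good with probability at least 1/q. Each of the [m] blocks of [q] colorings halves
   the failure probability, and n^|T| < 2^m. *)
have [|||a aP] := @hitting_tuple _ _ good q.-1 (q * m).
- by rewrite card_ffun card_ord expn_gt0 T_gt0.
- move=> g; rewrite card_ffun card_ord prednK // /good.
  case: (boolP (dinjectiveb g (vset H))) => [/dinjectiveP injg|_] /=.
    exact: card_good_colorings.
  have -> : #|(fun f : {ffun 'I_n -> T} => true)| = #|{ffun 'I_n -> T}|.
    exact: eq_card.
  by rewrite card_ffun card_ord leq_pmull.
- rewrite prednK // card_ffun card_ord.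
  have lt_n : n ^ #|T| < 2 ^ m.
    by rewrite /m mulnC expnM ltn_exp2r // trunc_log_ltn.
  have le_q : 2 ^ m * q.-1 ^ (q * m) <= q ^ (q * m).
    rewrite !(expnM _ q m) -expnMn leq_exp2r ?muln_gt0 ?T_gt0 //.
    by have := double_expn_le q.-1; rewrite prednK.
  (* For [q = 1] the power may vanish, and multiplying by it would lose strictness. *)
  have [->|pos] := posnP (q.-1 ^ (q * m)); first by rewrite muln0 expn_gt0 q_gt0.
  by rewrite (leq_trans _ le_q) // ltn_pmul2r.
- have /boolp.choice[s sP] := fun i => perm_of_key (fun x => r (a i x)).
  exists s; apply/coveringP => g injg.
  have [i iP] := aP (finfun g); exists i => x y xy.
  have [xV yV _] := edge_vset xy; apply: sP.
  have injg' : dinjectiveb (finfun g) (vset H).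
    by apply/dinjectiveP => u v uV vV; rewrite !ffunE; apply: injg.
  move: iP; rewrite /good injg' => /forall_inP iP.
  have := iP x xV; have := iP y yV; rewrite !ffunE => /eqP -> /eqP ->.
  exact: rP.
Qed.

(** * Lower bounds: paths and matchings *)

Lemma embedding_extends n (s1 : seq T) (s2 : seq 'I_n) :
  #|T| <= n -> uniq s1 -> uniq s2 -> size s1 = size s2 ->
  exists2 g : T -> 'I_n, injective g & map g s1 = s2.
Proof.
(* Start from any injection and correct it by a permutation of ['I_n]. *)
move=> leTn u1 u2 sz; pose g x := widen_ord leTn (enum_rank x).
have injg : injective g.
  by move=> x y /(congr1 val) /= /val_inj /enum_rank_inj.
have [||s sE] := @perm_map_exists 'I_n (map g s1) s2 _ u2; rewrite ?size_map //.
  by rewrite map_inj_uniq.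
exists (s \o g); last by rewrite map_comp.
by move=> x y /perm_inj /injg.
Qed.

Lemma path_lower_bound a b c n t : edge H a b -> edge H b c -> a != c ->
  #|T| <= n -> coverable H (complete n) t -> n <= (2 ^ t).+1.
Proof.
move=> ab bc ac leTn [pi /coveringP cov].
have [_ _ nab] := edge_vset ab; have [_ _ nbc] := edge_vset bc.
case: n => [|n] // in leTn pi cov *.
pose v x : {ffun 'I_t -> bool} := [ffun i => pi i x < pi i ord0].
have injv : {in predC1 ord0 &, injective v}.
  move=> x z; rewrite !inE => x0 z0 vE; apply/eqP; apply/negPn/negP => xz.
  have [|||g injg [ga gb gc]] := @embedding_extends _ [:: a; b; c]
    [:: x; ord0; z] leTn; rewrite //= ?inE ?negb_or ?nab ?nbc ?ac ?x0 ?xz //.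
    by rewrite eq_sym z0.
  have [i iP] := cov g (in2W injg).
  have := iP _ _ ab; have := iP _ _ bc; rewrite ga gb gc => lt0z ltx0.
  move/ffunP/(_ i): vE; rewrite !ffunE ltx0 => /esym.
  by rewrite ltnNge ltnW.
have := leq_card_in _ _ injv.
by rewrite card_ffun card_bool card_ord cardC1 card_ord.
Qed.

Lemma matching_lower_bound a b c d n t : edge H a b -> edge H c d ->
  uniq [:: a; b; c; d] ->
  #|T| <= n -> coverable H (complete n) t -> n./2 <= 2 ^ t.
Proof.
move=> ab cd u leTn [pi /coveringP cov].
have lt0 (j : 'I_n./2) : j.*2 < n.
  by rewrite ltnW // -gtn_half_double.
have lt1 (j : 'I_n./2) : j.*2.+1 < n.
  by rewrite -gtn_half_double.
pose e j := Ordinal (lt0 j); pose o j := Ordinal (lt1 j).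
pose v j : {ffun 'I_t -> bool} := [ffun i => pi i (e j) < pi i (o j)].
have injv : injective v.
  move=> j k vE; apply/eqP; apply/negPn/negP => jk.
  (* The second pair is embedded in reverse, so the covering permutation gives the two codes
     different bits. *)
  have [|||g injg [ga gb gc gd]] := @embedding_extends _ [:: a; b; c; d]
    [:: e j; o j; o k; e k] leTn; rewrite //.
    by move: jk; rewrite /= !inE -!val_eqE /=; lia.
  have [i iP] := cov g (in2W injg).
  have := iP _ _ ab; have := iP _ _ cd; rewrite ga gb gc gd => ltk ltj.
  move/ffunP/(_ i): vE; rewrite !ffunE ltj => /esym.
  by rewrite ltnNge ltnW.
by have := leq_card _ injv; rewrite card_ffun card_bool !card_ord.
Qed.

Lemma star_at_center c : no_isolated H -> c \in vset H ->
  (forall x y, edge H x y -> x = c) \/ (forall x y, edge H x y -> y = c) ->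
  star_at H c.
Proof.
move=> noiso cV cP; split=> // x y xV yV.
have incident u w : uedge H u w -> (u == c) || (w == c).
  by case: cP => cP /orP[] /cP ->; rewrite eqxx ?orbT.
have symu u w : uedge H u w = uedge H w u by rewrite /uedge orbC.
have spoke u : u \in vset H -> u != c -> uedge H u c.
  move=> uV uc; have [w uw] := noiso u uV.
  by have := incident _ _ uw; rewrite (negPf uc) /= => /eqP <-.
apply/idP/andP => [xy|[xy /orP[]/eqP E]].
- by split; [case/orP: xy => /edge_vset[] // _ _; rewrite eq_sym | exact: incident].
- by rewrite E symu spoke // -E eq_sym.
- by rewrite E spoke // -E.
Qed.

(** Without the two configurations, any two edges share a tail or share a head. Two distinct edges
    with a common tail have distinct heads, so a third edge cannot share its head with both and must
    share the tail; dually for heads. *)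
Lemma path_or_matching : 2 <= #|eset H| -> no_isolated H -> dag H ->
  ~ rooted_star H ->
  (exists a b c, [/\ edge H a b, edge H b c & a != c]) \/
  (exists a b c d, [/\ edge H a b, edge H c d & uniq [:: a; b; c; d]]).
Proof.
move=> edges noiso dagH nstar.
have [r rP] := dag_rank dagH.
apply: contrapT => /not_orP[noP noM]; apply: nstar.
have nopath a b c : edge H a b -> edge H b c -> False.
  move=> ab bc; apply: noP; exists a, b, c; split=> //.
  apply/eqP => E; have := ltn_trans (rP _ _ ab) (rP _ _ bc).
  by rewrite E ltnn.
have share a b c d : edge H a b -> edge H c d -> a = c \/ b = d.
  move=> ab cd; apply: contrapT => /not_orP[/eqP ac /eqP bd].
  apply: noM; exists a, b, c, d; split=> //=.
  have [_ _ nab] := edge_vset ab; have [_ _ ncd] := edge_vset cd.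
  rewrite !inE !negb_or nab ac bd ncd /= !andbT.
  apply/andP; split; apply/eqP => E.
    by apply: (nopath c d b); rewrite // -E.
  by apply: (nopath a b d); rewrite // E.
have /card_gt1P[[a b] [[c d] [ab cd neq]]] := edges.
have [aV bV _] := edge_vset ab.
have [E|E] := share _ _ _ _ ab cd.
- have bd : b <> d by move=> E'; rewrite E E' eqxx in neq.
  have src x y : edge H x y -> x = a.
    move=> xy; have [//|yb] := share _ _ _ _ xy ab.
    have [->//|yd] := share _ _ _ _ xy cd.
    by case: bd; rewrite -yb -yd.
  by exists a; split; [apply: star_at_center => // |]; left.
- have ac : a <> c by move=> E'; rewrite E E' eqxx in neq.
  have tgt x y : edge H x y -> y = b.
    move=> xy; have [xa|//] := share _ _ _ _ xy ab.
    have [xc|->//] := share _ _ _ _ xy cd.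
    by case: ac; rewrite -xa -xc.
  by exists b; split; [apply: star_at_center => // |]; right.
Qed.

End DagCoverings.

Lemma coverable_lower_bound (T : finType) (H : digraph T) (n t : nat) :
  2 <= #|eset H| -> no_isolated H -> dag H -> ~ rooted_star H ->
  2 < n -> #|T| <= n -> coverable H (complete n) t -> n <= 2 ^ t.+2.
Proof.
move=> edges noiso dagH nstar n_gt2 leTn cov; rewrite 2!expnS.
case: (path_or_matching edges noiso dagH nstar).
  case=> a [b [c [ab bc ac]]].
  by have := path_lower_bound ab bc ac leTn cov; lia.
case=> a [b [c [d [ab cd u]]]].
by have := matching_lower_bound ab cd u leTn cov; lia.
Qed.

(** * Passage to real logarithms *)

Section Log2.
Variable R : realType.
Local Open Scope ring_scope.

Let ln2_gt0 : 0 < ln 2 :> R.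
Proof. by rewrite ln_gt0 // ltr1n. Qed.

Lemma log2_le_nat (n t : nat) : (0 < n)%N -> (n <= 2 ^ t)%N ->
  log2 n%:R <= t%:R :> R.
Proof.
move=> n_gt0 le_n; rewrite /log2 ler_pdivrMr // mulrC mulr_natr -lnXn //.
by rewrite -natrX ler_ln ?posrE ?ltr0n ?expn_gt0 // ler_nat.
Qed.

Lemma nat_le_log2 (n t : nat) : (2 ^ t <= n)%N -> t%:R <= log2 n%:R :> R.
Proof.
move=> le_n; have n_gt0 : (0 < n)%N by apply: leq_trans le_n; rewrite expn_gt0.
rewrite /log2 ler_pdivlMr // mulrC mulr_natr -lnXn //.
by rewrite -natrX ler_ln ?posrE ?ltr0n ?expn_gt0 // ler_nat.
Qed.

End Log2.

Theorem theorem1 (R : realType) (T : finType) (H : digraph T)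
    (H_edges : 2 <= #|eset H|) (H_noiso : no_isolated H)
    (H_dag : dag H) (H_nstar : ~ rooted_star H) :
  exists c C : R,
    [/\ (0 < c)%R, (0 < C)%R
      & exists N : nat, forall n : nat, N <= n ->
          (c * log2 n%:R <= (tau H (complete n))%:R <= C * log2 n%:R)%R].
Proof.
have T_gt0 : 0 < #|T|.
  have /card_gt1P[[a b] _] := H_edges.
  by apply/card_gt0P; exists a.
(* The factor 2 absorbs the successor in [(trunc_log 2 n).+1]. *)
pose K := #|T| ^ #|vset H| * #|T| * 2.
have K_gt0 : 0 < K by rewrite !muln_gt0 expn_gt0 T_gt0.
exists 2^-1%R, K%:R%R; split; rewrite ?invr_gt0 ?ltr0n //.
(* From 16 on, log n >= 4, hence log n - 2 >= (log n)/2; the summand [#|T|] leaves room to embed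
   [T]. *)
exists (16 + #|T|) => n le_n.
have n16 : 2 ^ 4 <= n by lia.
have cov := coverable_log n H_dag T_gt0.
have [cov_tau /(_ _ cov) le_tau] := tauP cov.
have n_gt0 : 0 < n by lia.
have log4 := nat_le_log2 R n16.
apply/andP; split.
  have le_n2 : n <= 2 ^ (tau H (complete n)).+2.
    by apply: (coverable_lower_bound (H := H)) => //; lia.
  have := log2_le_nat R n_gt0 le_n2.
  rewrite -addn2 natrD => le_log; lra.
apply: (@le_trans _ _ (K * trunc_log 2 n)%:R%R).
  rewrite ler_nat (leq_trans le_tau) // /K -!mulnA !leq_mul2l.
  have : 0 < trunc_log 2 n by rewrite trunc_log_gt0; lia.
  by move=> ?; apply/orP; right; apply/orP; right; lia.
by rewrite natrM ler_wpM2l // nat_le_log2 // trunc_logP.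
Qed.
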